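(* Let $g$ be an arbitrary conformal metric on the Riemann sphere satisfying $$g\Bigl(\frac1x\Bigr)=|x|^4\,g(x),\qquad x\in\mathbb C.$$ Define the transformed metric $$T[g](x)=g(x)+\frac{g\bigl(\frac{x}{x-1}\bigr)}{|x-1|^4}+g(1-x).$$ Then, for $x\in\mathbb C$, $$T[g](1-x)=T[g](x),\qquad T[g]\Bigl(\frac1x\Bigr)=|x|^4\,T[g](x).$$
   Context: The Riemann sphere is identified with $\mathbb C\cup\{\infty\}$; a conformal metric is given by a positive (continuous) density $g$ on $\mathbb C$, corresponding to $g(x)\,dx$ with $dx$ Lebesgue measure. Expressions at exceptional points are understood through limits: the middle term of $T[g]$ at $x=1$ is defined by its limit, and the inversion identities at $x=0$ are understood as $\lim_{x\to0}|x|^{-4}g(1/x)=g(0)$ (i.e. $\lim_{x\to\infty}|x|^4g(x)=g(0)$), and similarly for $T[g]$. *)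

(* Defs.v *)
From Stdlib Require Export Reals.
From Coquelicot Require Export Coquelicot.

Open Scope R_scope.

(* [g] is the density of the metric g(x) dx in the affine chart.  In the chart
   w = 1/x, where dx = |w|^-4 dw, the density is |w|^-4 g(1/w); it must extend
   to a positive continuous density at w = 0, that is, at infinity. *)
Definition conformal_metric (g : C -> R) : Prop :=
  (forall x : C, 0 < g x) /\
  (forall x : C, continuous g x) /\
  (exists l : R, 0 < l /\
     filterlim (fun w : C => g (/ w)%C / Cmod w ^ 4) (locally' (RtoC 0)) (locally l)).

(* g(1/x) = |x|^4 g(x) on C; at x = 0 the identity reads
   lim_(x -> 0) |x|^-4 g(1/x) = g(0). *)
Definition inversion_identity (g : C -> R) : Prop :=
  (forall x : C, x <> RtoC 0 -> g (1 / x)%C = Cmod x ^ 4 * g x) /\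
  filterlim (fun x : C => g (1 / x)%C / Cmod x ^ 4) (locally' (RtoC 0)) (locally (g (RtoC 0))).

(* Meaningful for x <> 1 only. *)
Definition middle_formula (g : C -> R) (x : C) : R :=
  g (x / (x - 1))%C / Cmod (x - 1)%C ^ 4.

Definition middle_limit (g : C -> R) (l : R) : Prop :=
  filterlim (middle_formula g) (locally' (RtoC 1)) (locally l).

(* [iota] selects the unique limit, and is arbitrary when there is none. *)
Definition middle_term (g : C -> R) (x : C) : R :=
  if Ceq_dec x (RtoC 1) then iota (middle_limit g) else middle_formula g x.

Definition T (g : C -> R) (x : C) : R :=
  g x + middle_term g x + g (1 - x)%C.

(* Main.v *)
Require Import Defs.
From Stdlib Require Import Lra.

(** The six Moebius maps permuting 0, 1 and infinity form the anharmonic group,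
    generated by x |-> 1 - x and x |-> 1 / x.  A map h of this group acts on
    densities by g |-> (g o h) |h'|^2, and |h'|^2 = |x|^-4 for the inversion.
    A density invariant under the inversion has an orbit of at most three terms
    under this group, with coset representatives x, x / (x - 1) and 1 - x;
    [T g] is the sum over these cosets, so the group merely permutes its terms.
    Explicitly, 1 - x exchanges the outer terms and fixes the middle one, while
    the inversion fixes the first term and exchanges the other two.

    The exceptional points are settled by rewriting the middle term.  By the
    inversion identity at (x - 1) / x = 1 - 1 / x, the middle term is
    g (1 - 1 / x) / |x|^4 for x <> 0 ([middle_formula_inverted]).  This
    expression is regular at x = 1, so the limit there exists and equals g 0,
    and from [middle_term_inverted] on the equalities are algebra.  The limit in
    the inversion identity for [T g] at 0 then amounts to continuity of [T g] at
    0, because |x|^-4 T[g](1 / x) = T[g](x) away from 0. *)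

(** * Continuity and punctured neighbourhoods in the complex plane *)

Lemma continuous_C_pair {U : UniformSpace} (f h : U -> R) (x : U) :
  continuous f x -> continuous h x ->
  continuous (fun u => (f u, h u) : C) x.
Proof.
  intros Hf Hh.
  apply (continuous_comp_2 f h (fun a b => (a, b) : C)); try assumption.
  apply continuous_ext with (f := fun p : C => p).
  - intros [a b]; reflexivity.
  - apply continuous_id.
Qed.

Lemma continuous_Re (z : C) : continuous (fun x : C => fst x) z.
Proof. destruct z; apply (@continuous_fst R_UniformSpace R_UniformSpace). Qed.

Lemma continuous_Im (z : C) : continuous (fun x : C => snd x) z.
Proof. destruct z; apply continuous_snd. Qed.

Lemma continuous_normsq (z : C) :
  continuous (fun x : C => fst x ^ 2 + snd x ^ 2) z.
Proof.
  apply (continuous_plus (fun x : C => fst x ^ 2) (fun x : C => snd x ^ 2)).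
  - apply (continuous_mult (fun x : C => fst x) (fun x : C => fst x * 1)).
    + apply continuous_Re.
    + apply (continuous_mult (fun x : C => fst x) (fun _ : C => 1)).
      * apply continuous_Re.
      * apply continuous_const.
  - apply (continuous_mult (fun x : C => snd x) (fun x : C => snd x * 1)).
    + apply continuous_Im.
    + apply (continuous_mult (fun x : C => snd x) (fun _ : C => 1)).
      * apply continuous_Im.
      * apply continuous_const.
Qed.

Lemma continuous_Cmod (z : C) : continuous Cmod z.
Proof.
  apply (continuous_comp (fun x : C => fst x ^ 2 + snd x ^ 2) sqrt);
    [| apply continuous_sqrt].
  apply continuous_normsq.
Qed.

Lemma continuous_Cmod_pow (n : nat) (z : C) :
  continuous (fun x : C => Cmod x ^ n) z.
Proof.
  induction n as [|n IH]; simpl.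
  - apply continuous_const.
  - apply (continuous_mult Cmod (fun x : C => Cmod x ^ n)).
    + apply continuous_Cmod.
    + exact IH.
Qed.

Lemma normsq_neq_0 (z : C) : z <> RtoC 0 -> fst z ^ 2 + snd z ^ 2 <> 0.
Proof.
  intros Hz H; apply Hz, Cmod_eq_0.
  unfold Cmod; rewrite H; apply sqrt_0.
Qed.

Lemma continuous_inv_at {U : UniformSpace} (f : U -> R) (x : U) :
  continuous f x -> f x <> 0 -> continuous (fun u => / f u) x.
Proof.
  intros Hf Hx.
  apply (continuous_comp f Rinv); [exact Hf | now apply continuous_Rinv].
Qed.

Lemma continuous_Cinv (z : C) : z <> RtoC 0 -> continuous Cinv z.
Proof.
  intros Hz.
  assert (Hi : continuous (fun x : C => / (fst x ^ 2 + snd x ^ 2)) z).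
  { apply (continuous_inv_at (fun x : C => fst x ^ 2 + snd x ^ 2)).
    - apply continuous_normsq.
    - now apply normsq_neq_0. }
  apply (continuous_C_pair (fun x : C => fst x / (fst x ^ 2 + snd x ^ 2))
                           (fun x : C => - snd x / (fst x ^ 2 + snd x ^ 2))).
  - apply (continuous_mult (fun x : C => fst x)); [apply continuous_Re | exact Hi].
  - apply (continuous_mult (fun x : C => - snd x)); [| exact Hi].
    apply (continuous_opp (fun x : C => snd x)), continuous_Im.
Qed.

Lemma continuous_Cminus_from (a z : C) : continuous (fun x : C => (a - x)%C) z.
Proof.
  apply (continuous_C_pair (fun x : C => fst a + - fst x)
                           (fun x : C => snd a + - snd x)).
  - apply (continuous_plus (fun _ : C => fst a) (fun x : C => - fst x)).
    + apply continuous_const.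
    + apply (continuous_opp (fun x : C => fst x)), continuous_Re.
  - apply (continuous_plus (fun _ : C => snd a) (fun x : C => - snd x)).
    + apply continuous_const.
    + apply (continuous_opp (fun x : C => snd x)), continuous_Im.
Qed.

(** Uniqueness of limits at a point, hence the evaluation of [iota], needs the
    point not to be isolated. *)
Lemma locally'_C_proper (z : C) : ProperFilter' (locally' z).
Proof.
  constructor; [| apply locally'_filter].
  intros [eps H].
  pose proof (cond_pos eps) as He.
  apply (H (fst z + eps / 2, snd z)).
  - split.
    + change (Rabs (fst z + eps / 2 - fst z) < eps).
      rewrite Rabs_pos_eq; lra.
    + apply ball_center.
  - intros E; apply (f_equal fst) in E; simpl in E; lra.
Qed.

Lemma continuous_filterlim' {U V : UniformSpace} (f : U -> V) (x : U) :
  continuous f x -> filterlim f (locally' x) (locally (f x)).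
Proof.
  exact (filterlim_filter_le_1 f (filter_le_within (F := locally x) _)).
Qed.

(** * The middle term as a regular expression *)

Definition invariant_off_0 (g : C -> R) : Prop :=
  forall x : C, x <> RtoC 0 -> g (1 / x)%C = Cmod x ^ 4 * g x.

Lemma Cmod_pow_neq_0 (n : nat) (x : C) : x <> RtoC 0 -> Cmod x ^ n <> 0.
Proof. intros Hx; apply pow_nonzero; contradict Hx; now apply Cmod_eq_0. Qed.

Lemma Cminus_neq_0 (x y : C) : x <> y -> (x - y)%C <> RtoC 0.
Proof.
  intros Hxy E; apply Hxy.
  replace x with ((x - y) + y)%C by ring; rewrite E; ring.
Qed.

(** The number x / (x - 1) is the reciprocal of 1 - 1 / x, so the inversion
    identity trades the pole at 1 of the weight |x - 1|^-4 for one at 0. *)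
Lemma middle_formula_inverted (g : C -> R) (x : C) :
  invariant_off_0 g -> x <> RtoC 0 -> x <> RtoC 1 ->
  middle_formula g x = g (1 - / x)%C / Cmod x ^ 4.
Proof.
  intros Hg H0 H1.
  assert (H1' := Cminus_neq_0 x 1 H1).
  unfold middle_formula.
  assert (Hy : ((x - 1) / x)%C <> RtoC 0).
  { intros E; apply H1'.
    replace (x - 1)%C with ((x - 1) / x * x)%C by (field; exact H0).
    rewrite E; ring. }
  replace (x / (x - 1))%C with (1 / ((x - 1) / x))%C by (field; auto).
  rewrite (Hg _ Hy), Cmod_div by exact H0.
  replace ((x - 1) / x)%C with (1 - / x)%C by (field; exact H0).
  field; split; intros E; [apply H0 | apply H1']; now apply Cmod_eq_0.
Qed.

Lemma continuous_inverted_middle (g : C -> R) (z : C) :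
  (forall x : C, continuous g x) -> z <> RtoC 0 ->
  continuous (fun x : C => g (1 - / x)%C / Cmod x ^ 4) z.
Proof.
  intros Hg Hz.
  apply (continuous_mult (fun x : C => g (1 - / x)%C) (fun x : C => / Cmod x ^ 4)).
  - apply (continuous_comp (fun x : C => (1 - / x)%C) g); [| apply Hg].
    apply (continuous_comp Cinv (fun x : C => (1 - x)%C)).
    + now apply continuous_Cinv.
    + apply continuous_Cminus_from.
  - apply (continuous_inv_at (fun x : C => Cmod x ^ 4)).
    + apply continuous_Cmod_pow.
    + now apply Cmod_pow_neq_0.
Qed.

Lemma C1_neq_C0 : RtoC 1 <> RtoC 0.
Proof. intros E; apply (f_equal fst) in E; simpl in E; lra. Qed.

Lemma locally_1_neq_0 : locally (RtoC 1) (fun y : C => y <> RtoC 0).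
Proof.
  exists (mkposreal 1 Rlt_0_1); intros y [Hy _] E; rewrite E in Hy.
  change (Rabs (0 - 1) < 1) in Hy.
  rewrite Rabs_left in Hy; lra.
Qed.

Lemma middle_limit_inverted (g : C -> R) :
  (forall x : C, continuous g x) -> invariant_off_0 g ->
  middle_limit g (g (1 - / 1)%C / Cmod 1 ^ 4).
Proof.
  intros Hc Hg.
  apply (filterlim_ext_loc (fun x : C => g (1 - / x)%C / Cmod x ^ 4)).
  - (* The two expressions agree off {0, 1}, and 0 stays away from 1. *)
    unfold locally', within.
    apply (filter_imp (fun y : C => y <> RtoC 0)); [| exact locally_1_neq_0].
    intros y Hy0 Hy1; symmetry.
    now apply middle_formula_inverted.
  - apply (continuous_filterlim' (fun x : C => g (1 - / x)%C / Cmod x ^ 4)).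
    apply continuous_inverted_middle; [exact Hc | exact C1_neq_C0].
Qed.

(** One expression, continuous at 1, covers the generic points and the point 1,
    where the middle term is defined as a limit. *)
Lemma middle_term_inverted (g : C -> R) (x : C) :
  (forall x : C, continuous g x) -> invariant_off_0 g -> x <> RtoC 0 ->
  middle_term g x = g (1 - / x)%C / Cmod x ^ 4.
Proof.
  intros Hc Hg H0; unfold middle_term.
  destruct (Ceq_dec x (RtoC 1)) as [-> | H1].
  - apply (@iota_filterlim_locally _ R_CompleteNormedModule _ _
             (locally'_C_proper (RtoC 1))).
    now apply middle_limit_inverted.
  - now apply middle_formula_inverted.
Qed.

Lemma middle_term_0 (g : C -> R) : middle_term g 0 = g 0.
Proof.
  unfold middle_term, middle_formula.
  destruct (Ceq_dec 0 (RtoC 1)) as [E | _].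
  - now destruct C1_neq_C0.
  - replace (0 - 1)%C with (- (1))%C by ring.
    rewrite Cmod_opp, Cmod_1.
    replace (0 / - (1))%C with (RtoC 0); [field |].
    unfold Cdiv; ring.
Qed.

Lemma middle_term_1 (g : C -> R) :
  (forall x : C, continuous g x) -> invariant_off_0 g ->
  middle_term g 1 = g 0.
Proof.
  intros Hc Hg.
  rewrite middle_term_inverted by (trivial; exact C1_neq_C0).
  rewrite Cmod_1.
  replace (1 - / 1)%C with (RtoC 0) by (field; exact C1_neq_C0).
  field.
Qed.

(** * Invariance of the middle term and of the transformed density *)

Lemma middle_term_reflect (g : C -> R) (x : C) :
  (forall x : C, continuous g x) -> invariant_off_0 g ->
  middle_term g (1 - x)%C = middle_term g x.
Proof.
  intros Hc Hg.
  destruct (Ceq_dec x (RtoC 0)) as [-> | H0].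
  { replace (1 - 0)%C with (RtoC 1) by ring.
    now rewrite middle_term_1, middle_term_0. }
  destruct (Ceq_dec x (RtoC 1)) as [-> | H1].
  { replace (1 - 1)%C with (RtoC 0) by ring.
    now rewrite middle_term_1, middle_term_0. }
  rewrite (middle_term_inverted g x) by assumption.
  unfold middle_term.
  destruct (Ceq_dec (1 - x)%C (RtoC 1)) as [E | _].
  { destruct H0; replace x with (1 - (1 - x))%C by ring; rewrite E; ring. }
  unfold middle_formula.
  replace (1 - x - 1)%C with (- x)%C by ring.
  rewrite Cmod_opp.
  replace ((1 - x) / - x)%C with (1 - / x)%C; [reflexivity |].
  field; exact H0.
Qed.

Lemma middle_term_inversion (g : C -> R) (x : C) :
  (forall x : C, continuous g x) -> invariant_off_0 g -> x <> RtoC 0 ->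
  middle_term g (1 / x)%C = Cmod x ^ 4 * g (1 - x)%C.
Proof.
  intros Hc Hg H0.
  assert (Hx : (1 / x)%C <> RtoC 0).
  { intros E; apply C1_neq_C0.
    replace (RtoC 1) with (1 / x * x)%C by (field; exact H0).
    rewrite E; ring. }
  rewrite middle_term_inverted by assumption.
  replace (1 - / (1 / x))%C with (1 - x)%C by (field; exact H0).
  rewrite Cmod_div, Cmod_1 by exact H0.
  field; contradict H0; now apply Cmod_eq_0.
Qed.

Lemma T_reflect (g : C -> R) (x : C) :
  (forall x : C, continuous g x) -> invariant_off_0 g ->
  T g (1 - x)%C = T g x.
Proof.
  intros Hc Hg; unfold T.
  rewrite middle_term_reflect by assumption.
  replace (1 - (1 - x))%C with x by ring; ring.
Qed.

Lemma T_inversion (g : C -> R) :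
  (forall x : C, continuous g x) -> invariant_off_0 g -> invariant_off_0 (T g).
Proof.
  intros Hc Hg x H0; unfold T.
  rewrite middle_term_inversion, Hg, middle_term_inverted by assumption.
  replace (1 - 1 / x)%C with (1 - / x)%C by (unfold Cdiv; ring).
  field; contradict H0; now apply Cmod_eq_0.
Qed.

(** The reflection symmetry carries continuity at 1, where the middle term has
    its regular expression, over to 0. *)
Lemma continuous_T_0 (g : C -> R) :
  (forall x : C, continuous g x) -> invariant_off_0 g ->
  continuous (T g) (RtoC 0).
Proof.
  intros Hc Hg.
  assert (Hr : forall z : C, continuous (fun x : C => (1 - x)%C) z)
    by (intros z; apply continuous_Cminus_from).
  assert (Hm1 : continuous (middle_term g) (1 - 0)%C).
  { replace (1 - 0)%C with (RtoC 1) by ring.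
    apply (continuous_ext_loc _ (fun x : C => g (1 - / x)%C / Cmod x ^ 4)).
    - apply (filter_imp (fun y : C => y <> RtoC 0)); [| exact locally_1_neq_0].
      intros y Hy; symmetry.
      now apply middle_term_inverted.
    - apply continuous_inverted_middle; [exact Hc | exact C1_neq_C0]. }
  apply (continuous_plus (fun x : C => g x + middle_term g x)
                         (fun x : C => g (1 - x)%C)).
  - apply (continuous_plus g (middle_term g)); [apply Hc |].
    apply (continuous_ext (fun x : C => middle_term g (1 - x)%C)).
    + intros x; now apply middle_term_reflect.
    + now apply (continuous_comp (fun x : C => (1 - x)%C) (middle_term g)).
  - now apply (continuous_comp (fun x : C => (1 - x)%C) g).
Qed.

Theorem lemmaB1 :
  forall g : C -> R,
    conformal_metric g ->
    inversion_identity g ->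
    (exists l : R, middle_limit g l) /\
    (forall x : C, T g (1 - x)%C = T g x) /\
    inversion_identity (T g).
Proof.
  intros g (_ & Hc & _) [Hg _].
  split; [eexists; now apply middle_limit_inverted |].
  split; [intros x; now apply T_reflect |].
  assert (HT := T_inversion g Hc Hg).
  split; [exact HT |].
  apply (filterlim_ext_loc (T g)).
  - exists (mkposreal 1 Rlt_0_1); intros x _ Hx.
    rewrite (HT x Hx).
    field; contradict Hx; now apply Cmod_eq_0.
  - now apply continuous_filterlim', continuous_T_0.
Qed.
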